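(* Let $y\in L^2[0,1]$ be a real-valued function satisfying a Lipschitz condition $|y(x_1)-y(x_2)|\le L\,|x_1-x_2|$ for all $x_1,x_2\in[0,1]$, for some constant $L$. For an integer $J\ge 0$ put $k=2^{J+1}$ and let $$y_k(x)=\sum_{i=0}^{k-1}a_i\,h_i(x),\qquad a_i=\int_0^1 y(x)h_i(x)\,dx,$$ be the truncated Haar wavelet expansion of $y$ (with the functions $h_i$ as defined in the context). Then $\|y-y_k\|_2\to 0$ as $k\to\infty$, and the order of convergence is $$\|y-y_k\|_2=O\!\left(\frac1k\right),\qquad k=2^{J+1},$$ where $\|\cdot\|_2$ is the norm of $L^2[0,1]$.
   Context: Haar functions on $[0,1)$: $h_0(x)=1$ for $0\le x<1$ (and $0$ elsewhere). For $i\ge 1$ write uniquely $i=2^j+l$ with $j\ge 0$ and $0\le l\le 2^j-1$, and set $h_i(x)=2^{j/2}H(2^jx-l)$, where $$H(2^jx-l)=\begin{cases}1, & \dfrac{l}{2^j}\le x<\dfrac{l+\frac12}{2^j},\\[2mm] -1, & \dfrac{l+\frac12}{2^j}\le x<\dfrac{l+1}{2^j},\\[2mm] 0, & \text{elsewhere.}\end{cases}$$ The integer $j$ is the level of resolution, $l$ the translation parameter, and $J$ is the maximal level of resolution used in the truncated expansion. *)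

(* Defs.v *)
From HB Require Import structures.
From mathcomp Require Import all_boot all_order all_algebra.
From mathcomp Require Import all_classical all_reals all_analysis.

Set Implicit Arguments.
Unset Strict Implicit.
Unset Printing Implicit Defensive.

Import Order.TTheory GRing.Theory Num.Theory.
Import numFieldNormedType.Exports.

Local Open Scope classical_set_scope.
Local Open Scope ring_scope.

(* The value written H(2^j x - l). *)
Definition haarH (R : realType) (j l : nat) (x : R) : R :=
  if l%:R / 2 ^+ j <= x < (l%:R + 2^-1) / 2 ^+ j then 1
  else if (l%:R + 2^-1) / 2 ^+ j <= x < (l%:R + 1) / 2 ^+ j then -1
  else 0.

(* For i >= 1 the unique j, l with i = 2 ^ j + l and l < 2 ^ j are
   trunc_log 2 i and i - 2 ^ trunc_log 2 i; see haarE. *)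
Definition haar (R : realType) (i : nat) (x : R) : R :=
  if i == 0%N then (if 0 <= x < 1 then 1 else 0)
  else let j := trunc_log 2 i in
       let l := (i - 2 ^ j)%N in
       2 `^ (j%:R / 2) * haarH j l x.

Lemma haarE (R : realType) (j l : nat) (x : R) : (l < 2 ^ j)%N ->
  haar (2 ^ j + l) x = 2 `^ (j%:R / 2) * haarH j l x.
Proof.
move=> lj; rewrite /haar addn_eq0 expn_eq0 /=.
suff -> : trunc_log 2 (2 ^ j + l) = j by rewrite addKn.
by apply: trunc_log_eq => //; rewrite leq_addr expnS mul2n -addnn ltn_add2l.
Qed.

Definition haar_coef (R : realType) (y : R -> R) (i : nat) : R :=
  \int[lebesgue_measure]_(x in `[0, 1]) (y x * haar i x).

Definition haar_sum (R : realType) (y : R -> R) (k : nat) (x : R) : R :=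
  \sum_(0 <= i < k) haar_coef y i * haar i x.

(* Functions on [0, 1] are represented by f : R -> R, whose values outside
   [0, 1] are discarded: f \_ `[0, 1] is the extension by zero of the restriction
   of f to [0, 1]. *)
Definition in_L2_01 (R : realType) (f : R -> R) : Prop :=
  f \_ `[0, 1] \in Lfun (@lebesgue_measure R) 2%:E.

Definition L2norm01 (R : realType) (f : R -> R) : \bar R :=
  'N[@lebesgue_measure R]_2%:E [EFin \o (f \_ `[0, 1])%R]%E.

(* Main.v *)
(* The kernel sum_(i < 2^n) h_i(x) h_i(t) equals 2^n when x and t lie in the
   same dyadic interval of level n, and 0 otherwise: passing from n to n + 1
   adds the single wavelet of level n whose support contains x, which doubles
   the kernel on the half of the interval containing x and cancels it on the
   other half. Hence the truncated expansion at x is the average of y over the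
   dyadic interval of length 2^-n around x, which differs from y x by at most
   L / 2^n. The point x = 1, where every h_i vanishes, is negligible. *)

Require Import Defs.
From HB Require Import structures.
From mathcomp Require Import all_boot all_order all_algebra.
From mathcomp Require Import all_classical all_reals all_analysis.
From mathcomp Require Import measurable_realfun ring lra zify.

Set Implicit Arguments.
Unset Strict Implicit.
Unset Printing Implicit Defensive.

Import Order.TTheory GRing.Theory Num.Theory.
Import numFieldNormedType.Exports.

Local Open Scope classical_set_scope.
Local Open Scope ring_scope.

(** * Dyadic intervals and the wavelets supported on them *)

Definition dyadic (R : realType) (n m : nat) : set R :=
  `[m%:R / 2 ^+ n, m.+1%:R / 2 ^+ n[.

(** Scaling by [2 ^+ n] clears the denominators, so that later case analyses on membership are
    linear in [x * 2 ^+ n]. *)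
Lemma dyadicP (R : realType) n m (x : R) :
  (x \in dyadic n m) = (m%:R <= x * 2 ^+ n < m%:R + 1).
Proof.
rewrite /dyadic mem_setE in_itv /= ler_pdivrMr ?exprn_gt0//.
by rewrite ltr_pdivlMr ?exprn_gt0// natr1.
Qed.

Lemma dyadic_inj (R : realType) n l m (x : R) :
  x \in dyadic n l -> x \in dyadic n m -> l = m.
Proof.
rewrite !dyadicP => /andP[lx xl] /andP[mx xm].
have := le_lt_trans lx xm; have := le_lt_trans mx xl.
by rewrite !natr1 !ltr_nat; lia.
Qed.

Lemma indic_dyadicS (R : realType) n m (x : R) :
  \1_(dyadic n m) x =
    \1_(dyadic n.+1 m.*2) x + \1_(dyadic n.+1 m.*2.+1) x :> R.
Proof.
have d0 : m.*2%:R = 2 * m%:R :> R by rewrite -mul2n natrM.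
have d1 : m.*2.+1%:R = 2 * m%:R + 1 :> R by rewrite -natr1 d0.
rewrite !indicE !dyadicP d0 d1 exprS mulrCA.
set z := x * 2 ^+ n.
case: (leP m%:R z); case: (ltP z (m%:R + 1));
  case: (leP (2 * m%:R) (2 * z)); case: (leP (2 * m%:R + 1) (2 * z));
  case: (ltP (2 * z) (2 * m%:R + 1 + 1)) => /=;
  rewrite ?addr0 ?add0r //; lra.
Qed.

(** The two pieces of the wavelet are the halves of [dyadic n m]. With [indic_dyadicS], this makes
    the refinement of the kernel an identity between the indicators of these halves. *)
Lemma haarH_dyadic (R : realType) n m (x : R) :
  haarH n m x = \1_(dyadic n.+1 m.*2) x - \1_(dyadic n.+1 m.*2.+1) x.
Proof.
have p0 : 0 < 2 ^+ n :> R by rewrite exprn_gt0.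
have d0 : m.*2%:R = 2 * m%:R :> R by rewrite -mul2n natrM.
have d1 : m.*2.+1%:R = 2 * m%:R + 1 :> R by rewrite -natr1 d0.
rewrite /haarH !indicE !dyadicP d0 d1 exprS mulrCA.
rewrite !ler_pdivrMr// !ltr_pdivlMr//.
set z := x * 2 ^+ n.
case: (leP m%:R z); case: (ltP z (m%:R + 1)); case: (leP (m%:R + 2^-1) z);
  case: (leP (2 * m%:R) (2 * z)); case: (leP (2 * m%:R + 1) (2 * z));
  case: (ltP (2 * z) (2 * m%:R + 1 + 1)) => /=;
  rewrite ?subr0 ?sub0r ?oppr0 //; lra.
Qed.

Lemma haarH_eq0 (R : realType) n l m (x : R) :
  x \in dyadic n m -> l != m -> haarH n l x = 0.
Proof.
move=> xm lm; have : \1_(dyadic n l) x = 0 :> R.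
  by rewrite indicE; case: (boolP (_ \in _)) => // /dyadic_inj /(_ xm) /eqP;
    rewrite (negbTE lm).
rewrite indic_dyadicS haarH_dyadic !indicE.
(* The indicators of the two halves are nonnegative with sum 0, so both vanish, and so does their
   difference. *)
by case: (_ \in _); case: (_ \in _) => /=; lra.
Qed.

(** * The kernel of the partial sums *)

Lemma haar_kernel (R : realType) n (x : R) : 0 <= x < 1 ->
  exists m, [/\ (m < 2 ^ n)%N, x \in dyadic n m &
    forall t : R, \sum_(0 <= i < 2 ^ n) haar i x * haar i t =
      2 ^+ n * \1_(dyadic n m) t].
Proof.
move=> x01; elim: n => [|n [m [mn xm IH]]].
  exists 0%N; split=> //; first by rewrite dyadicP expr0 mulr1 add0r.
  move=> t; rewrite expn0 big_nat1 expr0 mul1r /haar /= x01 mul1r indicE.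
  by rewrite dyadicP expr0 mulr1 add0r; case: ifP.
(* The indices from [2 ^ n] on form the block of level [n]. Only the translation [m] is nonzero at
   [x], and its two factors 2^(n/2) multiply to [2 ^+ n]. *)
have step t : \sum_(0 <= i < 2 ^ n.+1) haar i x * haar i t =
    2 ^+ n * (\1_(dyadic n m) t + haarH n m x * haarH n m t).
  rewrite (@big_cat_nat _ _ _ (2 ^ n)%N) ?leq_exp2l//= IH mulrDr; congr (_ + _).
  rewrite -[X in index_iota X _]add0n big_addn expnS mul2n -addnn addnK.
  rewrite big_mkord (bigD1 (Ordinal mn))//= big1 ?addr0; last first.
    move=> i im; rewrite addnC !haarE// (haarH_eq0 xm) ?mulr0 ?mul0r//.
  rewrite addnC !haarE// mulrACA -powRD; last by rewrite pnatr_eq0 implybT.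
  by rewrite -splitr powR_mulrn.
have [xl|xr] : x \in dyadic n.+1 m.*2 \/ x \in dyadic n.+1 m.*2.+1.
  have : \1_(dyadic n m) x = 1 :> R by rewrite indicE xm.
  rewrite indic_dyadicS !indicE.
  by case: (_ \in _); [left | case: (_ \in _); [right | rewrite /=; lra]].
- exists m.*2; split=> //; first by rewrite expnS -mul2n ltn_pmul2l.
  (* Here [haarH n m x] is 1: the sum and the difference of the two half indicators add up to twice
     the left one. In the right half the value -1 leaves twice the right one. *)
  move=> t; rewrite step indic_dyadicS !haarH_dyadic.
  have -> : \1_(dyadic n.+1 m.*2.+1) x = 0 :> R.
    rewrite indicE; case: (boolP (_ \in _)) => // /(dyadic_inj xl); lia.
  have -> : \1_(dyadic n.+1 m.*2) x = 1 :> R by rewrite indicE xl.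
  by rewrite exprS; ring.
- exists m.*2.+1; split=> //; first by rewrite expnS; lia.
  move=> t; rewrite step indic_dyadicS !haarH_dyadic.
  have -> : \1_(dyadic n.+1 m.*2) x = 0 :> R.
    rewrite indicE; case: (boolP (_ \in _)) => // /dyadic_inj /(_ xr); lia.
  have -> : \1_(dyadic n.+1 m.*2.+1) x = 1 :> R by rewrite indicE xr.
  by rewrite exprS; ring.
Qed.

(** * Measurability and integrals *)

(* [measurableTypeR R] rather than [R]: both have the same measurable sets, but
   only the former has the measurable-space instance carrying
   [lebesgue_measure]. *)
Lemma measurable_dyadic (R : realType) n m :
  measurable (dyadic n m : set (measurableTypeR R)).
Proof. exact: measurable_itv. Qed.

Lemma lebesgue_measure_dyadic (R : realType) n m :
  lebesgue_measure (dyadic n m : set R) = ((2 ^+ n)^-1)%:E.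
Proof.
rewrite /dyadic lebesgue_measure_itv/= lte_fin ltr_pM2r ?invr_gt0 ?exprn_gt0//.
by rewrite ltr_nat ltnSn -EFinB -mulrBl -natr1 addrC addKr mul1r.
Qed.

Lemma dyadic_sub01 (R : realType) n m : (m < 2 ^ n)%N ->
  (dyadic n m : set R) `<=` `[0, 1].
Proof.
move=> mn t; rewrite /dyadic /= !in_itv/= => /andP[mt tm].
apply/andP; split; first by apply: le_trans mt; rewrite divr_ge0.
by rewrite (le_trans (ltW tm))// ler_pdivrMr ?exprn_gt0// mul1r -natrX ler_nat.
Qed.

(** A common shape for [h_0] and the wavelets, from which both measurability and boundedness follow
    without a case distinction. *)
Lemma haar_indic (R : realType) i : exists (a b : R) (A B : set R),
  [/\ measurable A, measurable B & haar i = (fun x => a * \1_A x + b * \1_B x)].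
Proof.
rewrite /haar; case: eqP => _.
  exists 1, 0, (dyadic 0 0), set0; split=> //; first exact: measurable_itv.
  apply/funext => x; rewrite mul1r mul0r addr0 indicE dyadicP expr0 mulr1 add0r.
  by case: ifP.
set j := trunc_log 2 i; set c := 2 `^ _.
exists c, (- c), (dyadic j.+1 (i - 2 ^ j).*2), (dyadic j.+1 (i - 2 ^ j).*2.+1).
split; [exact: measurable_itv|exact: measurable_itv|].
by apply/funext => x; rewrite haarH_dyadic mulrBr mulNr.
Qed.

Lemma measurable_haar (R : realType) i (D : set (measurableTypeR R)) :
  measurable_fun D (@haar R i).
Proof.
have [a [b [A [B [mA mB ->]]]]] := haar_indic R i.
by apply: measurable_funD; apply: measurable_funM => //;
  exact: measurable_indic.
Qed.

Lemma bounded_haar (R : realType) i (D : set R) : [bounded haar i x | x in D].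
Proof.
have [a [b [A [B [mA mB ->]]]]] := haar_indic R i.
exists (`|a| + `|b|); split; first by rewrite num_real.
move=> M ltM x _ /=; apply: le_trans (ltW ltM).
rewrite (le_trans (ler_normD _ _))// !normrM !indicE.
by apply: lerD; rewrite ler_piMr// ger0_norm// lern1 leq_b1.
Qed.

Lemma Rintegral_sum d (T : measurableType d) (R : realType)
    (mu : {measure set T -> \bar R}) (D : set T) (I : Type) (s : seq I)
    (h : I -> T -> R) :
  measurable D -> (forall i, mu.-integrable D (EFin \o h i)) ->
  \int[mu]_(x in D) (\sum_(i <- s) h i x) =
    \sum_(i <- s) \int[mu]_(x in D) h i x.
Proof.
move=> mD ih; elim: s => [|i s IH].
  rewrite big_nil; under eq_Rintegral do rewrite big_nil.
  by rewrite Rintegral_cst// mul0r.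
rewrite big_cons -IH -RintegralD//; last first.
  rewrite [X in mu.-integrable D X](_ : _ =
      fun x => (\sum_(i <- s) (h i x)%:E)%E).
    by apply: integrable_sum => // j _; exact: ih.
  by apply/funext => x /=; rewrite sumEFin.
by apply: eq_Rintegral => x _; rewrite big_cons.
Qed.

(** * Partial sums as local averages *)

Lemma haar_sum_average (R : realType) (y : R -> R) n (x : R) :
  (@lebesgue_measure R).-integrable `[0, 1] (EFin \o y) -> 0 <= x < 1 ->
  exists m, [/\ (m < 2 ^ n)%N, x \in dyadic n m &
    haar_sum y (2 ^ n) x =
      2 ^+ n * \int[lebesgue_measure]_(t in dyadic n m) y t].
Proof.
move=> iy /(haar_kernel n)[m [mn xm ker]]; exists m; split=> //.
have ih i : (@lebesgue_measure R).-integrable `[0, 1]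
    (EFin \o (fun t => y t * haar i t)).
  by apply: (integrableMl _ iy) => //;
    [exact: measurable_haar|exact: bounded_haar].
(* Moving the finite sum under the integral makes the kernel appear in the integrand. *)
have -> : haar_sum y (2 ^ n) x = \int[lebesgue_measure]_(t in `[0, 1])
    (\sum_(0 <= i < 2 ^ n) haar i x * (y t * haar i t)).
  rewrite Rintegral_sum//; last first.
    move=> i; rewrite (_ : _ \o _ =
      fun t => ((haar i x)%:E * (EFin \o (fun t => y t * haar i t)%R) t)%E) //.
    exact: integrableZl.
  by apply: eq_bigr => i _; rewrite RintegralZl// mulrC.
transitivity (\int[lebesgue_measure]_(t in `[0, 1])
    (2 ^+ n * (y \_ (dyadic n m)) t)).
  apply: eq_Rintegral => t _; rewrite patch_indic /= mulrCA -ker mulr_sumr.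
  by apply: eq_bigr => i _; rewrite mulrCA.
have sub := dyadic_sub01 (R := R) mn.
have mD := measurable_dyadic (R := R) n m.
have iD : (@lebesgue_measure R).-integrable (dyadic n m) (EFin \o y).
  by apply: integrableS mD sub iy => //; exact: measurable_itv.
rewrite RintegralZl//; last first.
  rewrite -restrict_EFin; apply: (@integrableS _ _ _ _ setT) => //.
  exact/(integrable_mkcond _ mD).
by rewrite -Rintegral_mkcondr (setIidr sub).
Qed.

(** The Lipschitz condition at the points 0 and 1 bounds an absolute value by [L]. *)
Lemma lipschitz01_ge0 (R : realType) (y : R -> R) (L : R) :
  L.-lipschitz_(`[0, 1]) y -> 0 <= L.
Proof.
move=> /(_ (0, 1)); rewrite /= !in_itv/= !lexx ler01 sub0r normrN normr1 mulr1.
by move=> /(_ (conj isT isT)); exact: le_trans.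
Qed.

Lemma haar_sum_dist (R : realType) (y : R -> R) (L : R) n (x : R) :
  (@lebesgue_measure R).-integrable `[0, 1] (EFin \o y) ->
  L.-lipschitz_(`[0, 1]) y -> 0 <= x < 1 ->
  `|y x - haar_sum y (2 ^ n) x| <= L / 2 ^+ n.
Proof.
move=> iy lip x01; have [m [mn xm ->]] := haar_sum_average n iy x01.
have sub := dyadic_sub01 (R := R) mn.
have mD := measurable_dyadic (R := R) n m.
have muD : (@lebesgue_measure R (dyadic n m) < +oo)%E.
  by rewrite lebesgue_measure_dyadic ltry.
have iD : (@lebesgue_measure R).-integrable (dyadic n m) (EFin \o y).
  by apply: integrableS mD sub iy => //; exact: measurable_itv.
have icst (c : R) : (@lebesgue_measure R).-integrable (dyadic n m)
    (EFin \o (fun=> c)).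
  apply: measurable_bounded_integrable => //.
  by exists `|c|; split; [rewrite num_real|move=> M cM t _; exact: ltW].
have p0 : 0 < 2 ^+ n :> R by rewrite exprn_gt0.
(* A constant equals its own average. Writing both [y x] and the bound as averages reduces the claim
   to a pointwise estimate on [dyadic n m]. *)
have avg (c : R) :
    c = 2 ^+ n * \int[lebesgue_measure]_(t in dyadic n m) (fun=> c) t.
  rewrite Rintegral_cst//= lebesgue_measure_dyadic /= mulrCA.
  by rewrite mulfV ?mulr1// gt_eqF.
rewrite [y x in X in X <= _]avg -mulrBr -RintegralB// normrM gtr0_norm//.
rewrite [leRHS]avg ler_pM2l//.
have iB : (@lebesgue_measure R).-integrable (dyadic n m)
  (EFin \o (fun t => y x - y t)) by exact: (integrableB mD (icst (y x)) iD).
rewrite (le_trans (le_normr_Rintegral mD iB))//.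
apply: le_Rintegral => //; first exact: integrable_norm iB.
move=> t tm; have x1 := sub _ (set_mem xm); have t1 := sub _ tm.
have /= := lip (x, t) (conj x1 t1) => /le_trans; apply.
rewrite ler_wpM2l ?(lipschitz01_ge0 lip)//.
(* Both [x] and [t] lie in an interval of length 2^-n, which bounds their distance. *)
move/mem_set: tm; move: xm; rewrite !dyadicP => xm tm.
rewrite -(ler_pM2r p0) mulVf ?gt_eqF// -[X in _ * X](gtr0_norm p0) -normrM.
by rewrite mulrBl ler_norml; lra.
Qed.

(** * From a pointwise bound to the norm *)

Lemma L2norm01_le (R : realType) (f : R -> R) (C : R) : 0 <= C ->
  measurable_fun (`[0, 1] : set (measurableTypeR R)) f ->
  (forall x, 0 <= x < 1 -> `|f x| <= C) ->
  (L2norm01 f <= C%:E)%E.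
Proof.
move=> C0 mf fC; rewrite /L2norm01 unlock /=.
(* With [C] written as the square root of its square, it suffices to compare the integrals of the
   squares. *)
have -> : C%:E = ((C `^ 2)%:E `^ 2^-1)%E.
  by rewrite poweR_EFin -powRrM mulfV// powRr1.
have i0 (D : set R) (g : R -> R) :
    (0 <= \int[lebesgue_measure]_(x in D) (`|g x| `^ 2)%:E)%E.
  by apply: integral_ge0 => x _; rewrite lee_fin powR_ge0.
have mf2 : measurable_fun (`[0, 1[ : set (measurableTypeR R))
    (fun x => (`|f x| `^ 2)%:E).
  apply/measurable_EFinP; apply: (@measurableT_comp _ _ _ _ _ _ (@powR R ^~ 2)).
    exact: measurable_powR.
  apply: measurableT_comp => //; apply: measurable_funS mf => //.
  by apply: subset_itvl; rewrite bnd_simp.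
apply: gt0_ler_poweR; rewrite ?invr_ge0// ?in_itv/= ?leey ?andbT//.
  by rewrite lee_fin powR_ge0.
(* The endpoint 1, where no bound is assumed, is a null set and is dropped from the domain. *)
have -> : (\int[lebesgue_measure]_x (`|(f \_ `[0%R, 1%R]) x| `^ 2)%:E =
    \int[lebesgue_measure]_(x in `[0%R, 1%R[) (`|f x| `^ 2)%:E)%E.
  rewrite integral_itv_bndo_bndc// [RHS]integral_mkcond.
  apply: eq_integral => x _; rewrite !patchE.
  by case: ifP => // _; rewrite normr0 powR0.
apply: le_trans
  (_ : \int[lebesgue_measure]_(x in `[0%R, 1%R[) (C `^ 2)%:E <= _)%E.
  apply: ge0_le_integral => //.
  move=> x /=; rewrite in_itv /= lee_fin => /fC fx.
  by rewrite ge0_ler_powR// nnegrE.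
rewrite integral_cst//= lebesgue_measure_itv/= lte_fin ltr01 -EFinB subr0 mule1.
exact: lexx.
Qed.

(* The norm is extended-real valued; by the first conclusion it is eventually
   finite, so that fine is harmless in the second one. *)
Theorem theorem4p2 (R : realType) (y : R -> R) (L : R)
    (y_L2 : in_L2_01 y) (y_lip : L.-lipschitz_(`[0, 1]) y) :
  (L2norm01 (y \- haar_sum y (2 ^ J.+1)) @[J --> \oo] --> 0%E) /\
  (fun J : nat => fine (L2norm01 (y \- haar_sum y (2 ^ J.+1))) : R)
    =O_\oo (fun J : nat => 1 / (2 ^ J.+1)%:R : R).
Proof.
have m01 : measurable (`[0, 1] : set (measurableTypeR R)).
  exact: measurable_itv.
have my : measurable_fun (`[0, 1] : set (measurableTypeR R)) y.
  by apply/(measurable_restrictT _ m01); have /sub_Lfun_mfun/set_mem := y_L2.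
have in0 : `[0, 1]%classic (0 : R) by rewrite /= in_itv/= lexx ler01.
have L0 := lipschitz01_ge0 y_lip.
have iy : (@lebesgue_measure R).-integrable `[0, 1] (EFin \o y).
  apply: measurable_bounded_integrable => //.
    by rewrite /= lebesgue_measure_itv/= lte_fin ltr01 -EFinB ltry.
  (* Every point of the unit interval is within distance 1 of 0, so [y] differs from [y 0] by at
     most [L]. *)
  exists (`|y 0| + L); split; first by rewrite num_real.
  move=> M ltM x x01; apply: le_trans (ltW ltM).
  rewrite -[y x](subrK (y 0)) addrC (le_trans (ler_normD _ _))// lerD2l.
  have /= /le_trans := y_lip (x, 0) (conj x01 in0); apply.
  move: x01; rewrite /= in_itv/= subr0 => /andP[x0 x1].
  by rewrite ger0_norm// ler_piMr.
have mS n : measurable_fun (`[0, 1] : set (measurableTypeR R))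
    (y \- haar_sum y (2 ^ n)).
  apply: measurable_funB => //; apply: measurable_sum => i.
  by apply: measurable_funM => //; exact: measurable_haar.
have bound J :
    (L2norm01 (y \- haar_sum y (2 ^ J.+1))%R <= (L / 2 ^+ J.+1)%R%:E)%E.
  apply: L2norm01_le => //; first by rewrite divr_ge0// exprn_ge0.
  by move=> x; exact: haar_sum_dist.
have norm_ge0 J : (0 <= L2norm01 (y \- haar_sum y (2 ^ J.+1))%R)%E.
  exact: Lnorm_ge0.
split.
  apply: (@squeeze_cvge _ _ _ _ (cst 0%E) _
    (fun J => (L / 2 ^+ J.+1)%:E)); last 2 first.
  - exact: cvg_cst.
  - apply: cvg_EFin; first by apply: nearW.
    (* The first term is [L / 2] because the exponent is [J.+1]. *)
    rewrite (_ : _ \o _ = geometric (L / 2) 2^-1).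
      by apply: cvg_geometric; rewrite ger0_norm ?invr_ge0// invf_lt1// ltr1n.
    by apply/funext => J; rewrite /= exprS invfM mulrA exprVn.
  - by apply: nearW => J; rewrite /= norm_ge0 bound.
(* The constant must be strictly positive, whereas [L] may be 0. *)
apply/eqO_exP; exists (L + 1); first by rewrite ltr_wpDl.
apply: nearW => J; rewrite ger0_norm; last by rewrite fine_ge0.
rewrite ger0_norm ?divr_ge0// natrX.
have fin : L2norm01 (y \- haar_sum y (2 ^ J.+1)) \is a fin_num.
  by rewrite ge0_fin_numE// (le_lt_trans (bound J))// ltry.
rewrite -lee_fin fineK// (le_trans (bound J))// lee_fin mul1r.
by rewrite ler_wpM2r ?invr_ge0 ?exprn_ge0// lerDl.
Qed.
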